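(* For every integer $t\ge 2$ and every $i\in\{1,2\}$, $$\Phi^{(i)}(2t+1) = 2+\frac{2}{2t-1}.$$
   Context: Graphs are finite and may contain multiple edges but no loops. The chromatic index $\chi'(G)$ is the minimum $k$ such that $G$ has a proper $k$-edge-coloring (adjacent edges, including parallel edges, receive different colors). A graph $G$ with maximum degree $\Delta(G)$ is class $1$ if $\chi'(G)=\Delta(G)$ and class $2$ otherwise. For a real number $r\ge 2$, a nowhere-zero $r$-flow in $G$ is a pair $(D,f)$ where $D$ is an orientation of $G$ and $f\colon E(G)\to[1,r-1]$ is a function such that $\sum_{e\in E^+(v)}f(e)=\sum_{e\in E^-(v)}f(e)$ for every vertex $v$, where $E^+(v)$ and $E^-(v)$ are the sets of outgoing and incoming arcs at $v$. The circular flow number is $\phi_c(G)=\inf\{r : G \text{ has a nowhere-zero } r\text{-flow}\}$ (a graph with a bridge has no nowhere-zero flow, and then $\phi_c(G)=\infty$). Let $\mathcal{G}_{2t+1}$ be the set of all $(2t+1)$-regular class $1$ graphs $G$ such that there is no perfect matching $M$ of $G$ for which $G-M$ is bipartite. Define $$\Phi^{(1)}(2t+1)=\inf\{\phi_c(G) : G\in\mathcal{G}_{2t+1}\},$$ $$\Phi^{(2)}(2t+1)=\inf\{\phi_c(G) : G \text{ is a } (2t+1)\text{-regular class } 2 \text{ graph}\}.$$ *)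

(* Defs.v *)
From HB Require Import structures.
From mathcomp Require Import all_boot all_order all_algebra.
From mathcomp Require Import boolp classical_sets reals constructive_ereal ereal.

Set Implicit Arguments.
Unset Strict Implicit.
Unset Printing Implicit Defensive.

Import Order.TTheory GRing.Theory Num.Theory.

(* Finite loopless multigraphs: parallel edges are distinct elements of [edge]
   with the same set of ends; loops are excluded by requiring two ends. *)
Record mgraph := MGraph {
  vertex : finType;
  edge : finType;
  ends : edge -> {set vertex};
  card_ends : forall e, #|ends e| = 2 }.

Section Graphs.
Local Open Scope set_scope.
Variable G : mgraph.

Definition degree (v : vertex G) : nat := #|[set e : edge G | v \in ends e]|.

Definition max_degree : nat := \max_(v : vertex G) degree v.

Definition regular (d : nat) : Prop := forall v : vertex G, degree v = d.

Definition proper_edge_coloring (k : nat) (c : {ffun edge G -> 'I_k}) : bool :=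
  [forall e : edge G, forall f : edge G,
     (e != f) && ~~ [disjoint ends e & ends f] ==> (c e != c f)].

Definition edge_colorable (k : nat) : bool :=
  [exists c : {ffun edge G -> 'I_k}, proper_edge_coloring c].

Lemma edge_colorable_ex : exists k, edge_colorable k.
Proof.
exists #|edge G|; apply/existsP; exists [ffun e => enum_rank e].
apply/forallP => e; apply/forallP => f; apply/implyP => /andP[ef _].
by rewrite !ffunE (inj_eq enum_rank_inj).
Qed.

Definition chromatic_index : nat := ex_minn edge_colorable_ex.

Definition class1 : Prop := chromatic_index = max_degree.

Definition class2 : Prop := ~ class1.

Definition perfect_matching (M : {set edge G}) : Prop :=
  forall v : vertex G, #|[set e in M | v \in ends e]| = 1.

Definition delete_edges (M : {set edge G}) : mgraph :=
  @MGraph (vertex G) {e : edge G | e \notin M} (fun e => ends (val e))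
    (fun e => card_ends (val e)).

Definition bipartite : Prop :=
  exists A : {set vertex G}, forall e : edge G, #|ends e :&: A| = 1.

(* The arc obtained from [e] goes from [tail e] to [head e]. *)
Definition orientation (tail head : edge G -> vertex G) : Prop :=
  forall e, ends e = [set tail e; head e].

End Graphs.

Section Flows.
Local Open Scope ring_scope.
Variable R : realType.

Definition nowhere_zero_flow (G : mgraph) (r : R)
    (tail head : edge G -> vertex G) (f : edge G -> R) : Prop :=
  [/\ orientation tail head,
      forall e, 1 <= f e <= r - 1
    & forall v, \sum_(e | tail e == v) f e = \sum_(e | head e == v) f e].

Definition has_nowhere_zero_flow (G : mgraph) (r : R) : Prop :=
  exists tail head f, @nowhere_zero_flow G r tail head f.

Local Open Scope classical_set_scope.

(* Valued in the extended reals, where the infimum of the empty set is +oo. *)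
Definition circular_flow_number (G : mgraph) : \bar R :=
  ereal_inf [set r%:E | r in [set r : R | 2 <= r /\ has_nowhere_zero_flow G r]].

(* A predicate rather than a [set mgraph]: [mgraph] is too large a type for the
   universe of [set]. *)
Definition calG (d : nat) (G : mgraph) : Prop :=
  [/\ regular G d, class1 G
    & ~ exists M : {set edge G},
          perfect_matching M /\ bipartite (delete_edges M)].

Definition Phi1 (d : nat) : \bar R :=
  ereal_inf [set x | exists2 G : mgraph, calG d G & x = circular_flow_number G].

Definition Phi2 (d : nat) : \bar R :=
  ereal_inf [set x | exists2 G : mgraph, regular G d /\ class2 G
                                      & x = circular_flow_number G].

End Flows.

(* Main.v *)
Require Import Defs.
From mathcomp Require Import all_boot all_order all_algebra.
From mathcomp Require Import boolp classical_sets reals constructive_ereal ereal.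
From mathcomp Require Import zify ring lra fintype finset.
Import Order.TTheory GRing.Theory Num.Theory.
Local Open Scope ring_scope.

(* Lower bound. Let a (2t+1)-regular graph have an r-flow with r < 2 + 2/(2t-1).
   Comparing the number of arcs leaving and entering a vertex, and then the two ends
   of an edge, shows that every vertex has t or t+1 outgoing arcs and that adjacent
   vertices differ in this number. So the graph is bipartite, and by Koenig's theorem
   it is of class 1 and has a perfect matching, whose removal leaves it bipartite.

   Upper bound. Both families consist of long rings. A vertex has sign + or - according to
   whether it has t+1 or t outgoing arcs, and the flow values (before scaling) lie in
   [2t - 1 - 1/k, 2t + 1]. A ring closes up only if the flow on one of its odd cycles
   changes by 1 altogether; it does so by the slack 1/k in each of k pieces. On the
   discrete side the pieces are rigid.
   - Class 1: a flower snark with multiplicities. The cycle of the e_k, whose edges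
     have multiplicity t, alternates in every admissible bipartition, which forces the
     matching to contain a spoke at each a_i and so to match an odd cycle perfectly.
   - Class 2: Petersen graphs minus two adjacent vertices, strung along an odd cycle.
     Each piece transmits the colour of the cycle edge entering it, so that the two
     cycle edges at the remaining vertex of the cycle would have the same colour. *)

Set Implicit Arguments.
Unset Strict Implicit.
Unset Printing Implicit Defensive.

(** * Matchings and colourings of regular bipartite graphs *)

Section Koenig.
Local Open Scope nat_scope.
Variable G : mgraph.
Implicit Types (E : {set edge G}) (P Q : {set vertex G}).

Definition edges_at E (v : vertex G) : {set edge G} := [set e in E | v \in ends e].

Lemma sum_edges_at E P :
  \sum_(v in P) #|edges_at E v| = \sum_(e in E) #|ends e :&: P|.
Proof.
under eq_bigr => v _ do rewrite -sum1dep_card big_mkcondr /=.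
rewrite exchange_big /=; apply: eq_bigr => e _.
rewrite -big_mkcondr sum1dep_card; apply: eq_card => v.
by rewrite !inE andbC.
Qed.

Lemma sum_ends_regular E P d : (forall v, #|edges_at E v| = d) ->
  #|P| * d = \sum_(e in E) #|ends e :&: P|.
Proof.
by move=> regE; rewrite -sum_nat_const -sum_edges_at; apply: eq_bigr => v _; rewrite regE.
Qed.

Variable A : {set vertex G}.
Hypothesis bipA : forall e : edge G, #|ends e :&: A| = 1.

Lemma eq_end_in (e : edge G) a a' :
  a \in ends e -> a \in A -> a' \in ends e -> a' \in A -> a = a'.
Proof.
move=> ae aA a'e a'A; have /eqP/cards1P[x Ex] := bipA e.
have : a \in ends e :&: A by rewrite inE ae.
have : a' \in ends e :&: A by rewrite inE a'e.
by rewrite Ex !inE => /eqP-> /eqP->.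
Qed.

Lemma card_endsD (e : edge G) : #|ends e :&: ~: A| = 1.
Proof.
by have := cardsID A (ends e); rewrite bipA (card_ends e) setDE => -[].
Qed.

Lemma ex_end_out (e : edge G) : exists2 b, b \in ends e & b \notin A.
Proof.
have /eqP/cards1P[x Ex] := card_endsD e.
have : x \in ends e :&: ~: A by rewrite Ex set11.
by rewrite !inE => /andP[]; exists x.
Qed.

Definition nbrs E P : {set vertex G} :=
  [set b | (b \notin A) && [exists e in E, (b \in ends e) && (ends e :&: P != set0)]].

Definition hall E : bool :=
  [forall P : {set vertex G}, (P \subset A) ==> (#|P| <= #|nbrs E P|)].

(** Each of the [d * #|P|] edges of [E] at [P] ends in a neighbour of [P], and a neighbour absorbs
    at most [d] edges. *)
Lemma hall_regular E d : 0 < d -> (forall v, #|edges_at E v| = d) -> hall E.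
Proof.
move=> d0 regE; rewrite /hall; apply/forallP => P; apply/implyP => PA.
rewrite -(leq_pmul2r d0) !(sum_ends_regular _ regE); apply: leq_sum => e eE.
have [->|nz] := eqVneq (ends e :&: P) set0; first by rewrite cards0.
have le1 : #|ends e :&: P| <= 1 by rewrite -(bipA e) subset_leq_card ?setIS.
apply: leq_trans le1 _; rewrite card_gt0; apply/set0Pn.
have [b be bA] := ex_end_out e; exists b.
by rewrite !inE be bA /=; apply/existsP; exists e; rewrite eE be.
Qed.

(* Rado's argument: if both [e1] and [e2] at [a] were needed, the two violating
   sets would contradict the submodularity of the number of neighbours. *)
Lemma minimal_hall_unique E a : minset hall E -> a \in A -> #|edges_at E a| = 1.
Proof.
move=> /minsetP[hallE minE] aA.
have hE Q : Q \subset A -> #|Q| <= #|nbrs E Q|.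
  by move=> QA; move/forallP/(_ Q)/implyP: hallE; apply.
apply/eqP; rewrite eqn_leq; apply/andP; split; last first.
  have := hE [set a]; rewrite sub1set cards1 => /(_ aA).
  rewrite card_gt0 => /set0Pn[b]; rewrite inE => /andP[_ /existsP[e]].
  case/and3P=> eE _ /set0Pn[x]; rewrite !inE => /andP[xe /eqP xa].
  by rewrite card_gt0; apply/set0Pn; exists e; rewrite !inE eE -xa.
rewrite leqNgt; apply/negP => /card_gt1P[e1 [e2 []]].
rewrite !inE => /andP[e1E ae1] /andP[e2E ae2] e12.
have viol e : e \in E -> a \in ends e -> exists Q, [/\ Q \subset A, a \notin Q &
    #|nbrs (E :\ e) (a |: Q)| <= #|Q|].
  move=> eE ae; have : ~~ hall (E :\ e).
    apply/negP => /minE/(_ (subsetDl _ _)) /setP/(_ e).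
    by rewrite !inE eqxx eE.
  rewrite negb_forall => /existsP[P]; rewrite negb_imply -ltnNge => /andP[PA ltP].
  (* A violating set that avoids [a] would already violate Hall's condition for [E], since [a] is
     the only end of [e] in [A]. *)
  have aP : a \in P.
    apply/negPn/negP => aP; move: ltP; rewrite ltnNge (leq_trans (hE P PA)) //.
    apply/subset_leq_card/subsetP => b; rewrite !inE => /andP[-> /existsP[f]].
    case/and3P=> fE bf nz; apply/existsP; exists f; rewrite !inE fE bf nz !andbT /=.
    apply: contraTneq nz => ->; rewrite negbK; apply/eqP/setP => x; rewrite !inE.
    apply/negP => /andP[xe xP]; move: aP.
    by rewrite (eq_end_in ae aA xe (subsetP PA x xP)) xP.
  exists (P :\ a); split; first by rewrite (subset_trans _ PA) ?subsetDl.
    by rewrite !inE eqxx.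
  by rewrite setD1K // -ltnS (leq_trans ltP) // (cardsD1 a P) aP.
have [Q1 [Q1A aQ1 le1]] := viol e1 e1E ae1.
have [Q2 [Q2A aQ2 le2]] := viol e2 e2E ae2.
set N1 := nbrs _ _ in le1; set N2 := nbrs _ _ in le2.
have subE Q e f : Q \subset A -> a \notin Q -> a \in ends e -> f \in E ->
    ends f :&: Q != set0 -> f \in E :\ e.
  move=> QA aQ ae fE /set0Pn[x]; rewrite !inE => /andP[xf xQ]; rewrite fE andbT.
  apply: contraNneq aQ => fe; rewrite fe in xf.
  by rewrite (eq_end_in ae aA xf (subsetP QA x xQ)).
(* At [a], the edge [e1] survives in [E :\ e2] and every other edge in [E :\ e1]. *)
have hU : #|a |: (Q1 :|: Q2)| <= #|N1 :|: N2|.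
  apply: leq_trans (hE _ _) _; first by rewrite subUset sub1set aA subUset Q1A.
  apply/subset_leq_card/subsetP => b; rewrite !inE => /andP[-> /existsP[f]].
  case/and3P=> fE bf /set0Pn[x]; rewrite !inE => /andP[xf /orP[/eqP xa|xQ]] /=.
    rewrite xa in xf; have nz Q : ends f :&: (a |: Q) != set0.
      by apply/set0Pn; exists a; rewrite !inE xf eqxx.
    have [fe|fe] := eqVneq f e1; apply/orP; [right|left]; apply/existsP; exists f.
      by rewrite !inE fE bf nz fe e12.
    by rewrite !inE fE bf nz fe.
  case/orP: xQ => xQ; apply/orP; [left|right]; apply/existsP; exists f; rewrite bf.
    rewrite (subE Q1) //; last by apply/set0Pn; exists x; rewrite inE xf.
    by apply/set0Pn; exists x; rewrite !inE xf xQ orbT.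
  rewrite (subE Q2) //; last by apply/set0Pn; exists x; rewrite inE xf.
  by apply/set0Pn; exists x; rewrite !inE xf xQ orbT.
have hI : #|Q1 :&: Q2| <= #|N1 :&: N2|.
  apply: leq_trans (hE _ _) _; first by rewrite subIset ?Q1A.
  apply/subset_leq_card/subsetP => b; rewrite !inE => /andP[-> /existsP[f]].
  case/and3P=> fE bf /set0Pn[x]; rewrite !inE => /and3P[xf xQ1 xQ2] /=.
  apply/andP; split; apply/existsP; exists f; rewrite bf.
    rewrite (subE Q1) //; last by apply/set0Pn; exists x; rewrite inE xf.
    by apply/set0Pn; exists x; rewrite !inE xf xQ1 orbT.
  rewrite (subE Q2) //; last by apply/set0Pn; exists x; rewrite inE xf.
  by apply/set0Pn; exists x; rewrite !inE xf xQ2 orbT.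
(* Submodularity bounds [#|N1| + #|N2|] below by [#|Q1| + #|Q2| + 1], because the enlarged union
   also contains [a]. *)
have := leq_add hU hI; rewrite cardsUI cardsU1 !inE negb_or aQ1 aQ2 -addnA cardsUI.
by rewrite add1n ltnNge (leq_add le1 le2).
Qed.

(** A minimal Hall set of edges works: it has one edge at each vertex of [A], it reaches every
    vertex outside [A] by Hall's condition for [A] itself, and [#|A| = #|~: A|] leaves no room for a
    second edge there. *)
Lemma regular_matching E d : 0 < d -> (forall v, #|edges_at E v| = d) ->
  exists2 M : {set edge G}, M \subset E & forall v, #|edges_at M v| = 1.
Proof.
move=> d0 regE; have [M minM ME] := minset_exists (hall_regular d0 regE).
exists M => // v.
have inA a : a \in A -> #|edges_at M a| = 1 by exact: minimal_hall_unique.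
have cardA : #|A| = #|~: A|.
  apply/eqP; rewrite -(eqn_pmul2r d0) !(sum_ends_regular _ regE).
  by apply/eqP/eq_bigr => e _; rewrite bipA card_endsD.
have cardM : #|M| = #|A|.
  rewrite -[RHS]sum1_card -(eq_bigr _ inA) sum_edges_at -sum1_card.
  by apply: eq_bigr => e _; rewrite bipA.
have outM : \sum_(b in ~: A) #|edges_at M b| = #|~: A|.
  by rewrite sum_edges_at -cardA -cardM -sum1_card; apply: eq_bigr => e _; rewrite card_endsD.
have out1 b : b \in ~: A -> 1 <= #|edges_at M b|.
  have /minsetp/forallP/(_ A) := minM.
  rewrite subxx /= cardA => leN bA.
  have /eqP eqN : nbrs M A == ~: A.
    rewrite eqEcard leN andbT; apply/subsetP => x; rewrite !inE => /andP[-> _] //.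
  move: bA; rewrite -eqN inE => /andP[_ /existsP[e /and3P[eM be _]]].
  by rewrite card_gt0; apply/set0Pn; exists e; rewrite inE eM.
have [/inA//|vA] := boolP (v \in A).
have vA' : v \in ~: A by rewrite inE.
apply/eqP; rewrite eqn_leq out1 // andbT.
move: outM; rewrite (bigD1 v) //= (cardsD1 v) vA' /= => eqs.
have le2 : #|~: A :\ v| <= \sum_(i in ~: A | i != v) #|edges_at M i|.
  rewrite -sum1_card (eq_bigl (fun i => (i \in ~: A) && (i != v))); last first.
    by move=> i; rewrite !inE andbC.
  by apply: leq_sum => i /andP[iA _]; exact: out1.
by rewrite -(leq_add2r #|~: A :\ v|) -eqs leq_add2l.
Qed.

(** Perfect matchings are peeled off one at a time, and each becomes a colour class. *)
Lemma regular_colorable E d : (forall v, #|edges_at E v| = d) ->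
  exists c : edge G -> nat, (forall e, e \in E -> c e < d) /\
    (forall e f v, e \in E -> f \in E -> v \in ends e -> v \in ends f ->
       c e = c f -> e = f).
Proof.
elim: d E => [|d IHd] E regE.
  have E0 : E = set0.
    apply/setP => e; rewrite inE; apply/negP => eE.
    have [b be _] := ex_end_out e.
    have /eqP := regE b; rewrite cards_eq0 => /eqP/setP/(_ e).
    by rewrite !inE eE be.
  by exists (fun=> 0); rewrite E0; split=> [e|e f v]; rewrite inE.
have [M ME regM] := regular_matching (ltn0Sn d) regE.
have regD v : #|edges_at (E :\: M) v| = d.
  have -> : edges_at (E :\: M) v = edges_at E v :\: edges_at M v.
    by apply/setP => e; rewrite !inE; case: (v \in _); rewrite ?andbF ?andbT.
  rewrite cardsD (setIidPr _) ?regE ?regM ?subn1 //.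
  by apply/subsetP => e; rewrite !inE => /andP[/(subsetP ME)-> ->].
have [c [cd c_inj]] := IHd _ regD.
exists (fun e => if e \in M then d else c e); split=> [e eE|e f v eE fE ve vf].
  by case: ifPn => // eM; rewrite ltnW // ltnS cd // inE eM.
case: ifPn => eM; case: ifPn => fM.
- move=> _; have /eqP/cards1P[x Ex] := regM v.
  have : e \in edges_at M v by rewrite inE eM.
  have : f \in edges_at M v by rewrite inE fM.
  by rewrite Ex !inE => /eqP-> /eqP->.
- by move=> dc; have := cd f; rewrite -dc !inE fM fE ltnn => /(_ isT).
- by move=> dc; have := cd e; rewrite dc !inE eM eE ltnn => /(_ isT).
by apply: (c_inj e f v) => //; rewrite inE ?eM ?fM.
Qed.

End Koenig.

(** * Class 1 as colourability with the maximum degree *)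

Section Class.
Local Open Scope nat_scope.
Variable G : mgraph.

Lemma edges_at_setT (v : vertex G) : #|edges_at [set: edge G] v| = degree v.
Proof. by apply: eq_card => e; rewrite !inE. Qed.

Lemma edge_colorableP k : reflect
  (exists c : edge G -> nat, (forall e, c e < k) /\
     forall e f v, v \in ends e -> v \in ends f -> c e = c f -> e = f)
  (edge_colorable G k).
Proof.
apply: (iffP existsP) => [[c /forallP cP]|[c [ck c_inj]]].
  exists (fun e => nat_of_ord (c e)); split=> // e f v ve vf /val_inj cef.
  apply/eqP/negPn/negP => ef; move/forallP/(_ f)/implyP: (cP e).
  rewrite ef cef eqxx => /(_ _)/negP; apply => //.
  by apply/negP => /pred0P/(_ v); rewrite /= ve vf.
exists [ffun e => Ordinal (ck e)]; apply/forallP => e; apply/forallP => f.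
apply/implyP => /andP[ef]; apply: contraNN; rewrite !ffunE -val_eqE /= => /eqP cef.
by apply/pred0P => v /=; apply/negP => /andP[ve vf]; rewrite (c_inj e f v) ?eqxx in ef.
Qed.

Lemma degree_le_colors k (v : vertex G) : edge_colorable G k -> degree v <= k.
Proof.
move=> /edge_colorableP[c [ck c_inj]].
have inj : {in [set e : edge G | v \in ends e] &,
    injective (fun e => Ordinal (ck e))}.
  by move=> e f; rewrite !inE => ve vf [] /(c_inj e f v ve vf).
by rewrite /degree -(card_in_imset inj) (leq_trans (max_card _)) ?card_ord.
Qed.

Lemma class1_colorable : class1 G <-> edge_colorable G (max_degree G).
Proof.
rewrite /class1 /chromatic_index; case: ex_minnP => k colk mink; split=> [<- //|col].
apply/eqP; rewrite eqn_leq mink //=; apply/bigmax_leqP => v _.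
exact: degree_le_colors.
Qed.

Lemma max_degree_regular d (v : vertex G) : regular G d -> max_degree G = d.
Proof.
move=> regG; apply/eqP; rewrite eqn_leq; apply/andP; split.
  by apply/bigmax_leqP => u _; rewrite regG.
by rewrite -(regG v); apply: (leq_bigmax v).
Qed.

Lemma regular_class1 d : regular G d -> edge_colorable G d -> class1 G.
Proof.
move=> regG col; apply/class1_colorable.
have [v _|noV] := pickP (vertex G); first by rewrite (max_degree_regular v regG).
(* Without vertices the maximum degree is 0 whatever [d] is, but then there are no edges to
   colour. *)
apply/edge_colorableP; exists (fun=> 0).
have noE (e : edge G) : False.
  by have := card_ends e; rewrite eq_card0 // => v; have := noV v.
by split=> [e|e]; case: (noE e).
Qed.

Lemma bipartite_regular_class1 d : bipartite G -> regular G d -> class1 G.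
Proof.
move=> [A bipA] regG; apply: (regular_class1 regG); apply/edge_colorableP.
have regT v : #|edges_at [set: edge G] v| = d by rewrite edges_at_setT.
have [c [cd c_inj]] := regular_colorable bipA regT.
exists c; split=> [e|e f v]; first by rewrite cd ?inE.
by apply: c_inj; rewrite inE.
Qed.

Lemma bipartite_regular_matching d : bipartite G -> regular G d -> 0 < d ->
  exists M : {set edge G}, perfect_matching M /\ bipartite (delete_edges M).
Proof.
move=> [A bipA] regG d0.
have regT v : #|edges_at [set: edge G] v| = d by rewrite edges_at_setT.
have [M _ regM] := regular_matching bipA d0 regT.
by exists M; split; [exact: regM | exists A => e; exact: bipA].
Qed.

End Class.

(** The [d] edges at [v] have distinct colours among [d], so no colour is missing. *)
Lemma regular_full_coloring (G : mgraph) d (c : edge G -> nat) v x :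
  regular G d -> (forall e, (c e < d)%N) ->
  (forall e f v, v \in ends e -> v \in ends f -> c e = c f -> e = f) ->
  (x < d)%N -> exists2 e, v \in ends e & c e = x.
Proof.
move=> regG cd c_inj xd; pose C e := Ordinal (cd e).
have C_inj : {in [set e : edge G | v \in ends e] &, injective C}.
  by move=> e f; rewrite !inE => ve vf [] /(c_inj e f v ve vf).
have imT : C @: [set e : edge G | v \in ends e] = [set: 'I_d].
  apply/eqP; rewrite eqEcard subsetT cardsT card_ord /=.
  by rewrite (card_in_imset C_inj) -/(degree v) regG.
have : Ordinal xd \in C @: [set e : edge G | v \in ends e] by rewrite imT inE.
by case/imsetP => e; rewrite inE => ve [->]; exists e.
Qed.

Lemma cut_ends (T : finType) (x y : T) (A : {set T}) :
  x != y -> #|[set x; y] :&: A| = 1%N -> (x \in A) = (y \notin A).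
Proof.
move=> xy; case xA: (x \in A); case yA: (y \in A) => //.
  by rewrite (setIidPl _) ?cards2 ?xy // subUset !sub1set xA yA.
have -> : [set x; y] :&: A = set0; last by rewrite cards0.
apply/setP => v; rewrite !inE; apply/negP => /andP[/orP[]/eqP->];
  by rewrite ?xA ?yA.
Qed.

Lemma perfect_matching_ex (G : mgraph) (M : {set edge G}) v :
  perfect_matching M -> exists2 e, e \in M & v \in ends e.
Proof.
move=> /(_ v)/eqP/cards1P[e eE].
have : e \in [set e in M | v \in ends e] by rewrite eE set11.
by rewrite inE => /andP[eM ve]; exists e.
Qed.

Lemma perfect_matching_uniq (G : mgraph) (M : {set edge G}) v e f :
  perfect_matching M -> e \in M -> f \in M -> v \in ends e -> v \in ends f -> e = f.
Proof.
move=> /(_ v)/eqP/cards1P[x xE] eM fM ve vf.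
have : e \in [set e in M | v \in ends e] by rewrite inE eM.
have : f \in [set e in M | v \in ends e] by rewrite inE fM.
by rewrite xE !inE => /eqP-> /eqP->.
Qed.

Lemma delete_edges_cut (G : mgraph) (M : {set edge G}) (A : {set vertex (delete_edges M)})
    (e : edge G) :
  (forall e, #|@ends (delete_edges M) e :&: A| = 1%N) -> e \notin M ->
  #|ends e :&: (A : {set vertex G})| = 1%N.
Proof. by move=> cut eM; apply: (cut (Sub e eM)). Qed.

(** * Flows of small ratio force bipartiteness *)

Section LowerBound.
Variables (R : realType) (G : mgraph) (t : nat) (r : R).
Variables (tail head : edge G -> vertex G) (f : edge G -> R).
Hypotheses (t_gt0 : (0 < t)%N) (regG : regular G (2 * t + 1)).
Hypotheses (r_lt : r < 2 + 2 / (2 * t%:R - 1)).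
Hypothesis flow : nowhere_zero_flow r tail head f.

Let outdeg v := #|[pred e | tail e == v]|.
Let indeg v := #|[pred e | head e == v]|.

Lemma outdeg_indeg v : (outdeg v + indeg v = 2 * t + 1)%N.
Proof.
have [ori _ _] := flow.
rewrite -(regG v) /degree -(cardID [pred e | tail e == v]); congr (_ + _)%N.
  by rewrite /outdeg; apply: eq_card => e; rewrite !inE ori !inE
    [v == tail e]eq_sym andbC; case: (tail e == v).
rewrite /indeg; apply: eq_card => e; rewrite !inE ori !inE
  [v == tail e]eq_sym [v == head e]eq_sym.
case: (tail e =P v) => [te|//] /=; apply/negP => /eqP he.
by have := card_ends e; rewrite ori te he cards2 eqxx.
Qed.

Lemma flow_bounds (P : pred (edge G)) :
  #|P|%:R <= \sum_(e | P e) f e <= #|P|%:R * (r - 1).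
Proof.
have [_ fr _] := flow; rewrite -sum1_card natr_sum mulr_suml.
by apply/andP; split; apply: ler_sum => e _; have /andP[] := fr e; rewrite ?mul1r.
Qed.

Lemma flow_ratio_lt : (2 * t%:R - 1) * (r - 1) < 2 * t%:R + 1.
Proof.
have t1 : 1 <= t%:R :> R by rewrite ler1n.
have X0 : 0 < 2 * t%:R - 1 :> R by lra.
move: r_lt; rewrite -ltrBlDl ltr_pdivlMr // => rX.
lra.
Qed.

(** With [a] arcs on one side and [b] on the other, conservation gives [a <= b (r - 1)], hence
    [2 t (a - b) <= a + b = 2 t + 1], so [a - b] is at most 1. *)
Lemma outdegE v : outdeg v = t \/ outdeg v = t.+1.
Proof.
have [_ _ cons] := flow; have oi := outdeg_indeg v.
have t1 : 1 <= t%:R :> R by rewrite ler1n.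
have rho := flow_ratio_lt.
have /andP[lo uo] := flow_bounds [pred e | tail e == v].
have /andP[li ui] := flow_bounds [pred e | head e == v].
rewrite /= cons in lo uo.
have aux (a b : nat) : a%:R <= b%:R * (r - 1) -> ((2 * t - 1) * a <= (2 * t + 1) * b)%N.
  move=> ab; rewrite -(ler_nat R) !natrM natrD natrB ?natrM; last by lia.
  have b0 : 0 <= b%:R :> R by [].
  nra.
have := aux _ _ (le_trans lo ui); have := aux _ _ (le_trans li uo).
rewrite -/(outdeg v) -/(indeg v); nia.
Qed.

(** If both ends had the same out-degree, conservation at one end would give
    [f e >= t + 1 - (t - 1)(r - 1)] and at the other [f e <= t (r - 1) - t]. Together these
    contradict [flow_ratio_lt]. *)
Lemma outdeg_ends_neq e : outdeg (tail e) != outdeg (head e).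
Proof.
have [_ _ cons] := flow.
have t1 : 1 <= t%:R :> R by rewrite ler1n.
have rho := flow_ratio_lt.
have oiu := outdeg_indeg (tail e); have oiv := outdeg_indeg (head e).
have /andP[lou uou] := flow_bounds [pred e' | (tail e' == tail e) && (e' != e)].
have /andP[liu uiu] := flow_bounds [pred e' | head e' == tail e].
have /andP[lov uov] := flow_bounds [pred e' | tail e' == head e].
have /andP[liv uiv] := flow_bounds [pred e' | (head e' == head e) && (e' != e)].
have := cons (tail e); rewrite (bigD1 e) //= => consu.
have := cons (head e); rewrite [RHS](bigD1 e) //= => consv.
have cu : outdeg (tail e) = #|[pred e' | (tail e' == tail e) && (e' != e)]|.+1.
  by rewrite /outdeg (cardD1 e) inE eqxx; congr _.+1; apply: eq_card => x; rewrite !inE andbC.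
have cv : indeg (head e) = #|[pred e' | (head e' == head e) && (e' != e)]|.+1.
  by rewrite /indeg (cardD1 e) inE eqxx; congr _.+1; apply: eq_card => x; rewrite !inE andbC.
apply/eqP => eqo; move: lou uou liu uiu lov uov liv uiv.
rewrite -/(outdeg (head e)) -/(indeg (tail e)) /=.
move: cu cv; set x := #|_|; set y := #|_| => cu cv.
have [ot|ot] := outdegE (tail e).
  have -> : x = t.-1 by lia.
  have -> : y = t by lia.
  have -> : outdeg (head e) = t by lia.
  have -> : indeg (tail e) = t.+1 by lia.
  have -> : t.-1%:R = t%:R - 1 :> R by rewrite -subn1 natrB.
  rewrite -[t.+1]addn1 natrD; lra.
have -> : x = t by lia.
have -> : y = t.-1 by lia.
have -> : outdeg (head e) = t.+1 by lia.
have -> : indeg (tail e) = t by lia.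
have -> : t.-1%:R = t%:R - 1 :> R by rewrite -subn1 natrB.
rewrite -[t.+1]addn1 natrD; lra.
Qed.

Lemma flow_bipartite : bipartite G.
Proof.
have [ori _ _] := flow.
exists [set v | outdeg v == t] => e; rewrite ori.
have := outdeg_ends_neq e; have [tE|tE] := outdegE (tail e); rewrite tE.
  move=> nh; rewrite -(cards1 (tail e)); apply: eq_card => v; rewrite !inE.
  case: (v =P tail e) => [->|_] /=; first exact/eqP.
  by apply/negP => /andP[/eqP-> /eqP hE]; rewrite hE eqxx in nh.
move=> nh; rewrite -(cards1 (head e)); apply: eq_card => v; rewrite !inE.
case: (v =P head e) => [->|_]; rewrite ?orbF.
  by rewrite orbT; have [|hE] := outdegE (head e); [move/eqP | rewrite hE eqxx in nh].
by case: (v =P tail e) => // ->; rewrite tE; apply/eqP; lia.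
Qed.

End LowerBound.

(** * Graphs and flows given by bundles of parallel edges *)

Section Bundles.
Variables (V I : finType) (src dst : I -> V) (mu : I -> nat).
Hypothesis src_dst : forall i, src i != dst i.

Lemma bundle_card_ends (e : {i : I & 'I_(mu i)}) :
  #|[set src (tag e); dst (tag e)]| = 2%N.
Proof. by rewrite cards2 src_dst. Qed.

Definition bundle_graph : mgraph := MGraph bundle_card_ends.

Lemma big_bundle (T : Type) (idx : T) (op : Monoid.com_law idx) (P : pred I)
    (F : forall i, 'I_(mu i) -> T) :
  \big[op/idx]_(e : edge bundle_graph | P (tag e)) F (tag e) (tagged e) =
  \big[op/idx]_(i | P i) \big[op/idx]_(k < mu i) F i k.
Proof. by rewrite sig_big_dep; apply: eq_bigl => e; rewrite andbT. Qed.

Lemma bundle_degree (v : V) : @degree bundle_graph v =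
  (\sum_(i | src i == v) mu i + \sum_(i | dst i == v) mu i)%N.
Proof.
have cardE (h : I -> V) : (\sum_(i | h i == v) mu i =
    \sum_(e : edge bundle_graph | h (tag e) == v) 1)%N.
  rewrite (big_bundle _ (fun i => h i == v) (fun _ _ => 1%N)).
  by apply: eq_bigr => i _; rewrite sum1_card card_ord.
rewrite !cardE !sum1dep_card /degree -cardsUI; have -> :
  [set e : edge bundle_graph | src (tag e) == v] :&:
  [set e | dst (tag e) == v] = set0.
  apply/setP => e; rewrite !inE; apply/negP => /andP[/eqP se /eqP de].
  by have := src_dst (tag e); rewrite se de eqxx.
rewrite cards0 addn0; apply: eq_card => e; rewrite !inE.
by rewrite [v == src _]eq_sym [v == dst _]eq_sym.
Qed.

(** The weights are signed: a negative one stands for an arc against the direction from [src] to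
    [dst]. Dividing by [lo] brings the absolute values into [[1, hi / lo]], whence
    [r - 1 = hi / lo]. *)
Lemma bundle_flow (R : realType) (lo hi : R) (w : I -> nat -> R) :
  0 < lo -> (forall i k, (k < mu i)%N -> lo <= `|w i k| <= hi) ->
  (forall v, \sum_(i | src i == v) \sum_(k < mu i) w i k =
             \sum_(i | dst i == v) \sum_(k < mu i) w i k) ->
  has_nowhere_zero_flow bundle_graph (1 + hi / lo).
Proof.
move=> lo0 wb cons; pose W (e : edge bundle_graph) := w (tag e) (tagged e).
exists (fun e => if 0 <= W e then src (tag e) else dst (tag e)).
exists (fun e => if 0 <= W e then dst (tag e) else src (tag e)).
exists (fun e => `|W e| / lo); split.
- by move=> e; case: ifP => _ //; rewrite setUC.
- move=> e; have /andP[loW Whi] := wb (tag e) (tagged e) (ltn_ord _).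
  rewrite ler_pdivlMr // mul1r loW /= [1 + _]addrC addrK.
  by rewrite ler_pM2r ?invr_gt0.
move=> v; apply/eqP; rewrite -subr_eq0 -!mulr_suml -mulrBl mulf_eq0.
rewrite !(big_mkcond (fun e => (if _ then _ else _) == v)) -sumrB /=.
have := cons v; rewrite -(big_bundle _ (fun i => src i == v)).
rewrite -(big_bundle _ (fun i => dst i == v)) => /eqP.
rewrite -subr_eq0 !(big_mkcond (fun e => _ (tag e) == v)) -sumrB /= => /eqP sum0.
apply/orP; left; apply/eqP; rewrite -[RHS]sum0; apply: eq_bigr => e _; rewrite /W.
case: (leP 0 (w (tag e) (tagged e))) => w0; [rewrite ger0_norm //|rewrite ltr0_norm //];
  by case: (src _ == v); case: (dst _ == v); rewrite ?subr0 ?sub0r ?subrr ?opprK.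
Qed.

(** Properness becomes a finite comparison at each vertex. Only different positions of the list
    [star v] are compared; parallel edges are left to the injectivity of [c x]. *)
Lemma bundle_colorable k (c : I -> nat -> nat) (star : V -> seq I) :
  (forall x l, (l < mu x)%N -> (c x l < k)%N) ->
  (forall x, {in gtn (mu x) &, injective (c x)}) ->
  (forall x, (x \in star (src x)) && (x \in star (dst x))) ->
  (forall v, pairwise (fun x y => [forall l : 'I_(mu x), forall l' : 'I_(mu y),
     c x l != c y l']) (star v)) ->
  edge_colorable bundle_graph k.
Proof.
move=> ck c_inj starP pw; apply/edge_colorableP.
exists (fun e : edge bundle_graph => c (tag e) (tagged e)).
split=> [e|[x l] [y l'] v /=]; first exact: ck.
have inS z : v \in [set src z; dst z] -> z \in star v.
  by rewrite !inE => /orP[]/eqP->; have /andP[] := starP z.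
move=> /inS xv /inS yv cE; have [xy|xy] := eqVneq x y; last first.
  exfalso; have := pw v; move/(pairwiseP x) => pwv.
  have [lt|gt|/esym ixy] := ltngtP (index x (star v)) (index y (star v)).
  - have := pwv _ _ _ _ lt; rewrite !inE !index_mem !nth_index // => /(_ xv yv).
    by move/forallP/(_ l)/forallP/(_ l'); rewrite cE eqxx.
  - have := pwv _ _ _ _ gt; rewrite !inE !index_mem !nth_index // => /(_ yv xv).
    by move/forallP/(_ l')/forallP/(_ l); rewrite cE eqxx.
  by rewrite -(nth_index x xv) -(nth_index x yv) ixy eqxx in xy.
case: y / xy l' cE {yv} => l' cE; congr existT; apply: val_inj.
by apply: (c_inj x); rewrite ?inE /=.
Qed.

End Bundles.

(* With [a = 2 t - 1], [b = 2 t + 1] and [p = t - 1], one more than half of the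
   [2 p + 1] parallel edges go forwards and the net flow is [1 + z]. *)
Definition chord (R : realType) (a b z : R) (k : nat) : R :=
  if k == 0%N then a + z else if odd k then a else - b.

Lemma sum_chord (R : realType) (a b z : R) p :
  \sum_(k < (2 * p).+1) chord a b z k = a + z + p%:R * (a - b).
Proof.
elim: p => [|p IHp]; first by rewrite big_ord_recl big_ord0 mul0r /chord.
rewrite mulnS !big_ord_recr /= in IHp *.
rewrite IHp /chord /= mul2n odd_double /= -[p.+1]addn1 natrD.
by rewrite mulrDl mul1r !addrA.
Qed.

Lemma chord_bounds (R : realType) (lo hi a b z : R) k : 0 < lo ->
  lo <= a <= hi -> lo <= b <= hi -> lo <= a + z <= hi -> lo <= `|chord a b z k| <= hi.
Proof.
move=> lo0 ab bb zb; rewrite /chord; case: ifP => _; last case: ifP => _.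
- by rewrite ger0_norm //; lra.
- by rewrite ger0_norm //; lra.
by rewrite normrN ger0_norm //; lra.
Qed.

(** * Arithmetic of cyclic successors *)

Lemma ordS_eq n (i j : 'I_n) : (ordS i == j) = (i == ord_pred j).
Proof. exact: (can2_eq (@ordSK n) (@ord_predK n)). Qed.

Lemma modnS_small n i : (i < n -> i.+1 %% n = if i.+1 == n then 0 else i.+1)%N.
Proof. by case: eqP => [->|ni i_n]; rewrite ?modnn ?modn_small //; lia. Qed.

Lemma modn_pred_small n i : (i < n -> (i + n).-1 %% n = if i == 0 then n.-1 else i.-1)%N.
Proof.
case: eqP => [->|ni] i_n; first by rewrite modn_small //; lia.
by rewrite (_ : (i + n).-1 = (i.-1 + n)%N) ?modnDr ?modn_small //; lia.
Qed.

Lemma ordS_neq n (i : 'I_n) : (1 < n)%N -> i != ordS i.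
Proof.
move=> n1; apply/eqP => /(congr1 (@nat_of_ord n)); rewrite /= modnS_small //.
by have := ltn_ord i; case: eqP; lia.
Qed.

(** * The class 1 family *)

Section Flower.
Variables (m t : nat).
Hypotheses (m_gt0 : (0 < m)%N) (t_gt1 : (1 < t)%N).

Let n := (2 * m).+1.

(* The vertices are [a_i], [b_i] for [i < n] and [e_k] for [k < 2 n]; both the [b_i]
   and the [e_k] form a cycle, and [a_i] is joined to [b_i], [e_i] and [e_(i+n)]. *)
Definition flowerV : finType := ('I_n + 'I_n + 'I_(n + n))%type.
Definition flowerI : finType := ('I_n + 'I_n + ('I_n + 'I_n) + 'I_(n + n))%type.

Definition va (i : 'I_n) : flowerV := inl (inl i).
Definition vb (i : 'I_n) : flowerV := inl (inr i).
Definition ve (k : 'I_(n + n)) : flowerV := inr k.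

Definition ib (i : 'I_n) : flowerI := inl (inl (inl i)).
Definition iab (i : 'I_n) : flowerI := inl (inl (inr i)).
Definition iea (i : 'I_n) : flowerI := inl (inr (inl i)).
Definition iae (i : 'I_n) : flowerI := inl (inr (inr i)).
Definition ie (k : 'I_(n + n)) : flowerI := inr k.

Definition flower_src (x : flowerI) : flowerV :=
  match x with
  | inl (inl (inl i)) => vb i
  | inl (inl (inr i)) => va i
  | inl (inr (inl i)) => ve (lshift n i)
  | inl (inr (inr i)) => va i
  | inr k => ve k
  end.

Definition flower_dst (x : flowerI) : flowerV :=
  match x with
  | inl (inl (inl i)) => vb (ordS i)
  | inl (inl (inr i)) => vb i
  | inl (inr (inl i)) => va i
  | inl (inr (inr i)) => ve (rshift n i)
  | inr k => ve (ordS k)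
  end.

(** Chosen to make all degrees [2 t + 1]: the sizes meeting at [a_i] and at [b_i] are [2 t - 1], 1,
    1, and those at [e_k] are [t], [t], 1. *)
Definition flower_mu (x : flowerI) : nat :=
  match x with
  | inl (inl (inr _)) => (2 * t.-1).+1
  | inr _ => t
  | _ => 1
  end.

Lemma flower_src_dst x : flower_src x != flower_dst x.
Proof.
move: x => [[[i|i]|[i|i]]|k] //.
  by apply: (@ordS_neq n i); rewrite ltnS muln_gt0 m_gt0.
by apply: (@ordS_neq (n + n) k); rewrite addnS ltnS.
Qed.

Definition flower : mgraph := bundle_graph flower_mu flower_src_dst.

Section Incidence.
Variables (T : Type) (idx : T) (op : Monoid.com_law idx) (F : flowerI -> T).

Lemma flower_out v : \big[op/idx]_(x | flower_src x == v) F x =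
  match v with
  | inl (inl i) => op (F (iab i)) (F (iae i))
  | inl (inr i) => F (ib i)
  | inr k => if split k is inl i then op (F (iea i)) (F (ie k)) else F (ie k)
  end.
Proof.
rewrite !big_sumType /=.
case: v => [[i|i]|k].
- rewrite big_pred0 // (big_pred1 i) // big_pred0 // (big_pred1 i) // big_pred0 //.
  by rewrite !(Monoid.mul1m, Monoid.mulm1).
- rewrite (big_pred1 i) // !big_pred0 //.
  by rewrite !(Monoid.mul1m, Monoid.mulm1).
- case: (split_ordP k) => j -> /=; rewrite big_pred0 // big_pred0 //.
    rewrite (big_pred1 j) => [|x]; last exact: eq_lshift.
    rewrite big_pred0 // (big_pred1 (lshift n j)) //.
    by rewrite !(Monoid.mul1m, Monoid.mulm1).
  rewrite big_pred0 => [|x]; last exact: eq_lrshift.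
  rewrite big_pred0 // (big_pred1 (rshift n j)) //.
  by rewrite !(Monoid.mul1m, Monoid.mulm1).
Qed.

Lemma flower_in v : \big[op/idx]_(x | flower_dst x == v) F x =
  match v with
  | inl (inl i) => F (iea i)
  | inl (inr i) => op (F (ib (ord_pred i))) (F (iab i))
  | inr k => if split k is inr i then op (F (iae i)) (F (ie (ord_pred k)))
             else F (ie (ord_pred k))
  end.
Proof.
rewrite !big_sumType /=.
case: v => [[i|i]|k].
- rewrite big_pred0 // big_pred0 // (big_pred1 i) // !big_pred0 //.
  by rewrite !(Monoid.mul1m, Monoid.mulm1).
- rewrite (big_pred1 (ord_pred i)) => [|j]; last exact: ordS_eq.
  rewrite (big_pred1 i) // !big_pred0 //.
  by rewrite !(Monoid.mul1m, Monoid.mulm1).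
- case: (split_ordP k) => j -> /=; do 3!rewrite big_pred0 //.
    rewrite big_pred0 => [|x]; last exact: eq_rlshift.
    rewrite (big_pred1 (ord_pred (lshift n j))) => [|x]; last exact: ordS_eq.
    by rewrite !(Monoid.mul1m, Monoid.mulm1).
  rewrite (big_pred1 j) => [|x]; last exact: eq_rshift.
  rewrite (big_pred1 (ord_pred (rshift n j))) => [|x]; last exact: ordS_eq.
  by rewrite !(Monoid.mul1m, Monoid.mulm1).
Qed.

End Incidence.

Lemma flower_regular : regular flower (2 * t + 1).
Proof.
move=> v; rewrite bundle_degree flower_out flower_in.
case: v => [[i|i]|k] /=; [lia|lia|].
case: (split k) => j /=; lia.
Qed.

(** * Flow on the flower *)

Section Flow.
Variable R : realType.

Let T : R := t%:R.
Let d : R := m%:R^-1.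
Let lo : R := 2 * T - 1 - d.
Let hi : R := 2 * T + 1.
Let sg (i : nat) : R := if odd i then -1 else 1.
(** Around the odd cycle of the [b_i] the alternating signs sum to 1; the [m] odd positions give
    back [d = 1 / m] each, which closes the cycle. *)
Let z (i : nat) : R := if odd i then d else 0.

Let flow_b (i : nat) : R :=
  if odd i then 2 * T - (i./2.+1)%:R * d else 2 * T + 1 - (i./2)%:R * d.
(** The cycle of the [e_k] consists of two rounds of length [n]. On the first the spokes carry [2 T]
    in alternating directions. The second starts [1 / T] below [2 T + 1], a deficit that the [m]
    slacks make up in steps of [d / T]. *)
Let flow_e1 (i : nat) : R := if odd i then 2 * T + 1 else 2 * T - 1.
Let flow_e2 (i : nat) : R :=
  if odd i then 2 * T - 1 + (i./2.+1)%:R * d / T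
  else 2 * T + 1 - 1 / T + (i./2)%:R * d / T.

Definition flower_w (x : flowerI) (l : nat) : R :=
  match x with
  | inl (inl (inl i)) => flow_b i
  | inl (inl (inr i)) => sg i * chord (2 * T - 1) (2 * T + 1) (z i) l
  | inl (inr (inl i)) => sg i * (2 * T)
  | inl (inr (inr i)) => sg i * (2 * T - 1 - z i)
  | inr k => if (k < n)%N then flow_e1 k else flow_e2 (k - n)
  end.

Definition flower_net (x : flowerI) : R :=
  match x with
  | inl (inl (inr i)) => sg i * (1 + z i)
  | inr k => T * flower_w (inr k) 0
  | _ => flower_w x 0
  end.

Lemma flower_netE x : \sum_(l < flower_mu x) flower_w x l = flower_net x.
Proof.
case: x => [[[i|i]|[i|i]]|k]; rewrite /flower_net /=; rewrite ?big_ord1 //.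
  rewrite -mulr_sumr sum_chord; congr (_ * _).
  have -> : t.-1%:R = T - 1 by rewrite -subn1 natrB //; lia.
  by ring.
by rewrite sumr_const card_ord -[LHS]mulr_natl.
Qed.

Let T2 : 2 <= T. Proof. by rewrite ler_nat. Qed.
Let d01 : 0 < d <= 1.
Proof. by rewrite /d invr_gt0 ltr0n m_gt0 invf_le1 ?ltr0n // ler1n. Qed.

Let jd_bounds j : (j <= m)%N -> 0 <= j%:R * d <= 1.
Proof.
move=> jm; rewrite mulr_ge0 //=; last by have := d01; lra.
by rewrite ler_pdivrMr ?ltr0n // mul1r ler_nat.
Qed.

Let md : m%:R * d = 1. Proof. by rewrite divff // pnatr_eq0; lia. Qed.

Let jdT_bounds (x : R) : 0 <= x <= 1 -> [&& 0 <= x / T, x / T <= 1 / T & 1 / T <= 1].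
Proof.
move=> x01; have t2 := T2.
by rewrite ler_pM2r ?invr_gt0 ?ler_pdivrMr ?divr_ge0; lra.
Qed.

Lemma flower_w_bounds x l : lo <= `|flower_w x l| <= hi.
Proof.
have t2 := T2; have db := d01.
have sgn i (y : R) : `|sg i * y| = `|y|.
  by rewrite normrM /sg; case: ifP; rewrite ?normrN normr1 mul1r.
case: x => [[[i|i]|[i|i]]|k] /=; rewrite ?sgn.
- have i_n := ltn_ord i; rewrite /flow_b; case: ifP => oi.
    have B := @jd_bounds (i./2.+1) ltac:(lia).
    by rewrite ger0_norm /lo /hi; lra.
  have B := @jd_bounds (i./2) ltac:(lia).
  by rewrite ger0_norm /lo /hi; lra.
- by apply: chord_bounds; rewrite /lo /hi /z; try case: ifP; lra.
- by rewrite ger0_norm /lo /hi; lra.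
- by rewrite ger0_norm /lo /hi /z; case: ifP; lra.
have k_n := ltn_ord k; rewrite /lo /hi; case: ifP => kn.
  by rewrite /flow_e1; case: ifP => _; rewrite ger0_norm; lra.
rewrite /flow_e2; case: ifP => ok.
  have := @jd_bounds ((k - n)./2.+1) ltac:(lia) => /jdT_bounds /and3P[B1 B2 B3].
  by rewrite ger0_norm; lra.
have := @jd_bounds ((k - n)./2) ltac:(lia) => /jdT_bounds /and3P[B1 B2 B3].
by rewrite ger0_norm; lra.
Qed.

Let flow_bS i : flow_b i.+1 = flow_b i + sg i.+1 * (1 + z i.+1).
Proof.
rewrite /flow_b /sg /z /= uphalf_half; case: (odd i); rewrite /= ?add1n ?add0n;
  rewrite -?[i./2.+1%:R]natr1; move: (T) (d) (_./2%:R) => T' d' h; ring.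
Qed.

Let flow_e1S i : sg i.+1 * (2 * T) + T * flow_e1 i.+1 = T * flow_e1 i.
Proof. by rewrite /flow_e1 /sg /=; case: (odd i) => /=; move: (T) => T'; ring. Qed.

Let flow_e2S i :
  T * flow_e2 i.+1 = sg i.+1 * (2 * T - 1 - z i.+1) + T * flow_e2 i.
Proof.
have T0 : T != 0 by have := T2; lra.
rewrite /flow_e2 /sg /z /= uphalf_half; case: (odd i); rewrite /= ?add1n ?add0n;
  rewrite -?[i./2.+1%:R]natr1; move: (T) (d) (_./2%:R) T0 => T' d' h T0; by field.
Qed.

Lemma flower_flow : has_nowhere_zero_flow flower (1 + hi / lo).
Proof.
have t2 := T2; have db := d01; have T0 : T != 0 by lra.
have oddm : odd (2 * m) = false by rewrite oddM.
have halfm : (2 * m)./2 = m by rewrite mul2n doubleK.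
apply: (@bundle_flow _ _ _ _ _ _ _ _ _ flower_w).
- by rewrite /lo; lra.
- by move=> x l _; exact: flower_w_bounds.
move=> v; under eq_bigr do rewrite flower_netE.
under [RHS]eq_bigr do rewrite flower_netE.
rewrite flower_out flower_in; case: v => [[i|i]|k].
- by rewrite /flower_net /=; ring.
- rewrite /flower_net /= modn_pred_small //; case: i => -[|i] /= i_n.
    (* Position 0 closes the cycle: its predecessor [2 * m] carries [2 T + 1 - m * d = 2 T]. *)
    by rewrite /flow_b /sg /z /= oddm halfm md; ring.
  exact: flow_bS.
rewrite /flower_net; case: (split_ordP k) => j -> /=; have j_n := ltn_ord j.
  rewrite modn_pred_small ?ltn_addr // ltn_ord; case: j j_n => -[|j] /= _ j_n; last first.
    by rewrite (ltnW j_n) flow_e1S.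
  (* The predecessor of [e_0] is the last vertex of the second round. *)
  rewrite ltnNge (_ : (n <= (n + n).-1)%N) /=; last by lia.
  rewrite (_ : (n + n).-1 - n = 2 * m)%N; last by lia.
  by rewrite /flow_e2 oddm halfm md /flow_e1 /sg /=; field.
rewrite -[(2 * m + j + (n + n))%N]/((n + j + (n + n)).-1) modn_pred_small ?ltn_add2l //.
rewrite ltnNge leq_addr addKn /=; case: j j_n => -[|j] /= _ j_n; last first.
  rewrite [(2 * m + j.+1)%N]addnS ltnNge leq_addr /= subSS addKn; exact: flow_e2S.
(* The predecessor of [e_n] is the last vertex of the first round. *)
rewrite addn0 ltnS leqnn /flow_e1 oddm /flow_e2 /sg /z /=; by field.
Qed.

End Flow.

(** * The flower has no perfect matching with bipartite complement *)

Lemma flower_no_matching :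
  ~ exists M : {set edge flower}, perfect_matching M /\ bipartite (delete_edges M).
Proof.
move=> [M [pmM [A cutA]]].
pose E x (k : 'I_(flower_mu x)) : edge flower := Tagged (fun x => 'I_(flower_mu x)) k.
have cutE x k : E x k \notin M ->
    (flower_src x \in A) = (flower_dst x \notin A).
  by move=> /(delete_edges_cut cutA); apply: cut_ends; exact: flower_src_dst.
(* The bundle has [t >= 2] edges and [M] contains at most one of them, so some edge survives the
   deletion. *)
have alt k : (ve k \in A) = (ve (ordS k) \notin A).
  pose k0 : 'I_(flower_mu (ie k)) := Ordinal (ltnW t_gt1).
  pose k1 : 'I_(flower_mu (ie k)) := Ordinal t_gt1.
  have [k0M|] := boolP (E (ie k) k0 \in M); last exact: cutE.
  apply: (cutE (ie k) k1); apply/negP => k1M.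
  have /eqP := perfect_matching_uniq pmM k0M k1M (set21 _ _) (set21 _ _).
  by rewrite eq_Tagged.
have [A0 altn] : exists A0, forall k (k_n : (k < n + n)%N),
    (ve (Ordinal k_n) \in A) = A0 (+) odd k.
  exists (ve (Ordinal (ltn0Sn (2 * m + n))) \in A); elim=> [|k IHk] k_n.
    by rewrite addbF; congr (_ \in A); congr ve; apply: val_inj.
  rewrite [odd _]/= addbN -(IHk (ltnW k_n)) [X in _ = ~~ X]alt negbK.
  by congr (_ \in A); congr ve; apply: val_inj; rewrite /= modn_small.
(* As [n] is odd, [e_i] and [e_(i+n)] lie on opposite sides; the spoke from [a_i] to the one on its
   own side must be in [M]. *)
have spoke i : (E (iea i) ord0 \in M) || (E (iae i) ord0 \in M).
  apply/negPn/negP; rewrite negb_or => /andP[/cutE /= c1 /cutE /= c2].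
  move: c1; rewrite c2 negbK.
  have -> : lshift n i = Ordinal (ltn_ord (lshift n i)) by apply: val_inj.
  have -> : rshift n i = Ordinal (ltn_ord (rshift n i)) by apply: val_inj.
  by rewrite !altn /= oddD /= oddM; case: (A0); case: (odd i).
have no_ab i k : E (iab i) k \notin M.
  apply/negP => abM; have /orP[sM|sM] := spoke i.
    have /(congr1 tag) // := perfect_matching_uniq pmM abM sM (set21 _ _) (set22 _ _).
  have /(congr1 tag) // := perfect_matching_uniq pmM abM sM (set21 _ _) (set21 _ _).
have vb_inj : injective vb by move=> i j [].
pose x i := E (ib i) ord0 \in M.
(* No edge to [a_(i+1)] is in [M], so exactly one of the two cycle edges at [b_(i+1)] is. *)
have xS i : x (ordS i) = ~~ x i.
  have ordSi : i != ordS i by apply: ordS_neq; rewrite /n; lia.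
  have [e eM ve] := @perfect_matching_ex flower M (vb (ordS i)) pmM.
  case xi: (x i) => /=.
    apply/negbTE/negP => xSi.
    have /(congr1 tag) [] := perfect_matching_uniq pmM xi xSi (set22 _ _) (set21 _ _).
    by move/eqP; rewrite (negPf ordSi).
  case: e eM ve => [[[[j|j]|[j|j]]|j] k] eM; rewrite !inE //=.
    move=> /orP[]/eqP; first by move=> [->]; move: eM; rewrite /x (ord1 k).
    by move=> /vb_inj/ordS_inj ij; move: xi; rewrite /x ij -(ord1 k) [_ \in M]eM.
  by move: eM; rewrite (negPf (no_ab j k)).
have [x0 xn] : exists x0, forall k (k_n : (k < n)%N), x (Ordinal k_n) = x0 (+) odd k.
  exists (x ord0); elim=> [|k IHk] k_n.
    by rewrite addbF; congr x; apply: val_inj.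
  rewrite [odd _]/= addbN -(IHk (ltnW k_n)) -xS.
  by congr x; apply: val_inj; rewrite /= modn_small.
(* An alternating [x] cannot close up around a cycle of odd length. *)
have := xS ord_max; rewrite (_ : ordS ord_max = Ordinal (ltn0Sn (2 * m))); last first.
  by apply: val_inj; rewrite /= modnn.
rewrite (_ : ord_max = Ordinal (ltnSn (2 * m))); last exact: val_inj.
by rewrite !xn oddM; case: x0 {xn}.
Qed.

(** The odd cycle of the [b_i] needs three colours; the third goes to its last edge. *)
Definition colb (i : nat) : nat := (if i == 2 * m then 2 else odd i)%N.
Definition colb_prev (i : nat) : nat := (if i == 0 then 2 else odd i.-1)%N.

(** [bump x] enumerates the numbers other than [x]. The bundle at [a_i] avoids the two cycle colours
    at [b_i], which the spokes at [a_i] take. Around the [e_k], odd bundles take [t + 1 .. 2 t]; an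
    even one takes all of [0 .. t] except one value of [colb], which is left to the spokes at both
    of its ends. *)
Definition flower_col (x : flowerI) (l : nat) : nat :=
  match x with
  | inl (inl (inl i)) => colb i
  | inl (inl (inr i)) => bump (colb i) (bump (unbump (colb i) (colb_prev i)) l)
  | inl (inr (inl i)) => if odd i then colb_prev i else colb i
  | inl (inr (inr i)) => if odd i then colb i else colb_prev i
  | inr k => if odd k then (t.+1 + l)%N else bump (colb (if (k < n)%N then k : nat else k - n)%N) l
  end.

Definition flower_star (v : flowerV) : seq flowerI :=
  match v with
  | inl (inl i) => [:: iab i; iea i; iae i]
  | inl (inr i) => [:: ib i; ib (ord_pred i); iab i]
  | inr k => [:: match split k with inl i => iea i | inr i => iae i end;
                 ie k; ie (ord_pred k)]
  end.

Lemma flower_colorable : edge_colorable flower (2 * t + 1).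
Proof.
have colb3 i : (colb i < 3)%N by rewrite /colb; case: ifP => //; case: odd.
have colbp3 i : (colb_prev i < 3)%N by rewrite /colb_prev; case: ifP => //; case: odd.
have colb_neq (i : 'I_n) : colb i != colb_prev i.
  have i_n := ltn_ord i; rewrite /colb /colb_prev; apply/eqP.
  by case: eqP; case: eqP; lia.
have colbS (i : 'I_n) : colb (ord_pred i) = colb_prev i.
  have i_n := ltn_ord i; rewrite /= modn_pred_small // /colb /colb_prev.
  by have [i0|i0] := eqVneq (i : nat) 0%N; [rewrite eqxx | case: eqP; lia].
have chordN1 (i : 'I_n) l : colb i != bump (colb i) (bump (unbump (colb i) (colb_prev i)) l).
  exact: neq_bump.
have chordN2 (i : 'I_n) l :
    colb_prev i != bump (colb i) (bump (unbump (colb i) (colb_prev i)) l).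
  have pE : bump (colb i) (unbump (colb i) (colb_prev i)) = colb_prev i.
    by apply: unbumpK; rewrite inE /= eq_sym.
  by rewrite -{1}pE (inj_eq (can_inj (bumpK _))) neq_bump.
apply: (@bundle_colorable _ _ _ _ _ _ _ flower_col flower_star).
- case=> [[[i|i]|[i|i]]|k] l /=.
  + by move=> _; have := colb3 i; lia.
  + move: (colb3 i) (colbp3 i) (colb_neq i); rewrite /bump /unbump; lia.
  + by case: ifP => _ _; [have := colbp3 i|have := colb3 i]; lia.
  + by case: ifP => _ _; [have := colb3 i|have := colbp3 i]; lia.
  by case: ifP => _ lt_l; last rewrite /bump; lia.
- case=> [[[i|i]|[i|i]]|k] l l'; rewrite !inE /=; try lia.
    by move=> _ _ /(can_inj (bumpK _))/(can_inj (bumpK _)).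
  by case: ifP => _ _ _; [lia | move/(can_inj (bumpK _))].
- case=> [[[i|i]|[i|i]]|k]; rewrite ![flower_star _]/= !in_cons.
  + by rewrite ordSK !eqxx orbT.
  + by rewrite !eqxx !orbT.
  + rewrite eqxx orbT andbT.
    by case: split_ordP => j // /eqP; rewrite ?eq_lrshift // eq_lshift => /eqP->; rewrite eqxx.
  + rewrite eqxx !orbT /=.
    by case: split_ordP => j // /eqP; rewrite ?eq_rlshift // eq_rshift => /eqP->; rewrite eqxx.
  by rewrite ordSK !eqxx !orbT.
have pairF x y : (forall l l', (l < flower_mu x)%N -> (l' < flower_mu y)%N ->
    flower_col x l != flower_col y l') ->
    [forall l : 'I_(flower_mu x), forall l' : 'I_(flower_mu y),
      flower_col x l != flower_col y l'].
  by move=> xy; apply/forallP => l; apply/forallP => l'; apply: xy.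
have pw3 (r : rel flowerI) x y z : r x y -> r x z -> r y z -> pairwise r [:: x; y; z].
  by move=> /= -> -> ->.
case=> [[i|i]|k].
- apply: pw3; apply: pairF => l l' _ _ /=.
  + by case: ifP => _; rewrite eq_sym.
  + by case: ifP => _; rewrite eq_sym.
  by case: ifP => _; rewrite ?colb_neq // eq_sym colb_neq.
- apply: pw3; apply: pairF => l l' _ _ /=.
  + by rewrite colbS.
  + exact: chordN1.
  by rewrite colbS.
have colL (j : 'I_n) l : flower_col (ie (lshift n j)) l =
    if odd j then (t.+1 + l)%N else bump (colb j) l.
  by rewrite /= ltn_ord.
have colR (j : 'I_n) l : flower_col (ie (rshift n j)) l =
    if odd j then bump (colb j) l else (t.+1 + l)%N.
  by rewrite /= ltnNge leq_addr addKn oddD oddM /=; case: odd.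
have colpL (j : 'I_n) l : flower_col (ie (ord_pred (lshift n j))) l =
    if odd j then bump (colb_prev j) l else (t.+1 + l)%N.
  rewrite -colbS /= !modn_pred_small ?ltn_addr //.
  case: j => -[|j] j_n /=.
    by rewrite addnS /= oddD oddM.
  rewrite ltnW // [RHS]if_neg.
  by case: odd.
have colpR (j : 'I_n) l : flower_col (ie (ord_pred (rshift n j))) l =
    if odd j then (t.+1 + l)%N else bump (colb_prev j) l.
  rewrite -colbS /= -[(2 * m + j + (n + n))%N]/((n + j + (n + n)).-1).
  rewrite !modn_pred_small ?ltn_add2l //.
  case: j => -[|j] j_n /=.
    by rewrite addn0 ltnS leqnn oddM.
  rewrite addnS ltnNge leq_addr /= subSS addKn oddD oddM /=.
  by case: odd.
have dis b l l' : (l < t)%N -> bump b l != (t.+1 + l')%N.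
  by rewrite /bump => lt_l; apply/eqP; lia.
have dis3 b l' : (b < 3)%N -> b != (t.+1 + l')%N by move=> b3; apply/eqP; lia.
have splitL (j : 'I_n) : split (lshift n j) = inl j := unsplitK (inl j).
have splitR (j : 'I_n) : split (rshift n j) = inr j := unsplitK (inr j).
case: (split_ordP k) => j ->; apply: pw3; apply: pairF => l l' lt_l lt_l';
  rewrite ?colL ?colR ?colpL ?colpR ?splitL ?splitR /=; case: (odd j);
  first [exact: neq_bump | by apply: dis3; rewrite ?colb3 ?colbp3 | exact: dis
        | rewrite eq_sym; exact: dis].
Qed.

End Flower.

(** * The class 2 family *)

Section PetersenChain.
Variables (s t : nat).

Let p := s.+1.

(* Two cycles of odd lengths [4 p + 1] and [6 p + 1], joined by bundles of [2 t - 1]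
   edges. Block [j] has the outer vertices [4 j + 1 .. 4 j + 4] and the inner vertices
   [6 j + 1 .. 6 j + 6]; the first and the last of the latter are joined to each other
   by a bundle, and the other four to the outer vertices of the block. *)
Definition chainV : finType := ('I_(4 * p).+1 + 'I_(6 * p).+1)%type.
Definition chainI : finType :=
  ('I_(4 * p).+1 + 'I_(6 * p).+1 + ('I_(4 * p).+1 + 'I_p))%type.

Definition vout (k : nat) : chainV := inl (inord k).
Definition vin (q : nat) : chainV := inr (inord q).
Definition iout (k : nat) : chainI := inl (inl (inord k)).
Definition ispoke (k : nat) : chainI := inr (inl (inord k)).
Definition ichord (j : nat) : chainI := inr (inr (inord j)).

(** The pattern of the Petersen graph: close the four outer vertices of a block into a pentagon by
    one new vertex, and the inner vertices [6 j + 2 .. 6 j + 5] by another, joined to the first. The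
    offsets 4, 2, 5, 3 then make the inner pentagon a pentagram. Position 0 belongs to no block. *)
Definition spoke (k : nat) : nat :=
  if k == 0%N then 0%N else (6 * (k.-1 %/ 4) + nth 0 [:: 4; 2; 5; 3] (k.-1 %% 4))%N.

(** Meaningful only at [q = 0] and at residues 2 to 5; the ends of the chord bundles get filler
    values. *)
Definition spoke_inv (q : nat) : nat :=
  (4 * (q %/ 6) + nth 0 [:: 0; 0; 2; 4; 1; 3] (q %% 6))%N.

Definition chain_src (x : chainI) : chainV :=
  match x with
  | inl (inl k) => inl k
  | inl (inr q) => inr q
  | inr (inl k) => inl k
  | inr (inr j) => vin (6 * j + 1)
  end.

Definition chain_dst (x : chainI) : chainV :=
  match x with
  | inl (inl k) => inl (ordS k)
  | inl (inr q) => inr (ordS q)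
  | inr (inl k) => vin (spoke k)
  | inr (inr j) => vin (6 * j + 6)
  end.

Definition chain_mu (x : chainI) : nat :=
  match x with
  | inl _ => 1
  | inr _ => (2 * t.-1).+1
  end.

Lemma inord_eq n a (b : 'I_n.+1) : (a < n.+1)%N -> (inord a == b) = (a == b :> nat).
Proof. by move=> a_n; rewrite -val_eqE /= inordK. Qed.

Lemma spoke_lt k : (k < (4 * p).+1 -> spoke k < (6 * p).+1)%N.
Proof.
rewrite /spoke; case: k => [|k] //= k_p.
have : (k %% 4 < 4)%N by rewrite ltn_mod.
have : (k %/ 4 < p)%N by rewrite ltn_divLR //; lia.
by move: (k %% 4)%N => [|[|[|[|r]]]] //=; lia.
Qed.

Lemma chain_src_dst x : chain_src x != chain_dst x.
Proof.
move: x => [[k|q]|[k|j]] //=.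
- exact: (@ordS_neq _ k).
- exact: (@ordS_neq _ q).
apply/eqP => -[/(congr1 (@nat_of_ord _))]; rewrite !inordK; have := ltn_ord j; lia.
Qed.

Definition chain : mgraph := bundle_graph chain_mu chain_src_dst.

Lemma spoke_eq k q : (k < (4 * p).+1)%N -> (q < (6 * p).+1)%N ->
  (spoke k == q) = ((q == 0)%N || (1 < q %% 6)%N) && (k == spoke_inv q).
Proof.
move=> k_p q_p; rewrite /spoke /spoke_inv.
have rq : (q %% 6 < 6)%N by rewrite ltn_mod.
have eq_q := divn_eq q 6; move: (q %/ 6)%N (q %% 6)%N rq eq_q => j r r6 ->.
case: k k_p => [|k] k_p /=.
  by move: r r6 => [|[|[|[|[|[|r]]]]]] //= _; apply/eqP/andP => h; try case: h; lia.
have rk : (k %% 4 < 4)%N by rewrite ltn_mod.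
have eq_k := divn_eq k 4; move: (k %/ 4)%N (k %% 4)%N rk eq_k => i u u4 ->.
move: r r6 => [|[|[|[|[|[|r]]]]]] // _; move: u u4 => [|[|[|[|u]]]] // _ /=;
  by apply/eqP/andP => h; try case: h; lia.
Qed.

Lemma spoke_inv_lt q : (q < (6 * p).+1)%N -> (q == 0)%N || (1 < q %% 6)%N ->
  (spoke_inv q < (4 * p).+1)%N.
Proof.
rewrite /spoke_inv; have rq : (q %% 6 < 6)%N by rewrite ltn_mod.
have eq_q := divn_eq q 6; move: (q %/ 6)%N (q %% 6)%N rq eq_q => j r r6 ->.
by move: r r6 => [|[|[|[|[|[|r]]]]]] //= _; lia.
Qed.

Section Incidence.
Variables (T : Type) (idx : T) (op : Monoid.com_law idx) (F : chainI -> T).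

Lemma chain_out v : \big[op/idx]_(x | chain_src x == v) F x =
  match v with
  | inl k => op (F (inl (inl k))) (F (inr (inl k)))
  | inr q => op (F (inl (inr q))) (if q %% 6 == 1 then F (ichord (q %/ 6)) else idx)%N
  end.
Proof.
rewrite !big_sumType /=; case: v => [k|q].
  rewrite (big_pred1 k) // big_pred0 // (big_pred1 k) // big_pred0 //.
  by rewrite !(Monoid.mul1m, Monoid.mulm1).
have q_p := ltn_ord q.
rewrite big_pred0 // (big_pred1 q) // big_pred0 // !(Monoid.mul1m, Monoid.mulm1).
have chordE (j : 'I_p) : (vin (6 * j + 1) == inr q :> chainV) = (6 * j + 1 == q)%N.
  by rewrite -[LHS]/(inord _ == q) inord_eq //; have := ltn_ord j; lia.
rewrite (eq_bigl _ _ chordE); congr (op _ _); case: ifP => q6; last first.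
  by rewrite big_pred0 // => j; lia.
rewrite (big_pred1 (inord (q %/ 6))) // => j.
rewrite /= [RHS]eq_sym inord_eq; move: q6 q_p; rewrite /p;
  by move: (nat_of_ord q) (nat_of_ord j) => a b; lia.
Qed.

Lemma chain_in v : \big[op/idx]_(x | chain_dst x == v) F x =
  match v with
  | inl k => F (inl (inl (ord_pred k)))
  | inr q => op (F (inl (inr (ord_pred q))))
      (if (q == 0 :> nat) || (1 < q %% 6)%N then F (ispoke (spoke_inv q))
       else if (q %% 6 == 1)%N then idx else F (ichord (q %/ 6).-1))
  end.
Proof.
rewrite !big_sumType /=; case: v => [k|q].
  rewrite (big_pred1 (ord_pred k)) => [|j]; last exact: ordS_eq.
  by rewrite !big_pred0 // !(Monoid.mul1m, Monoid.mulm1).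
have q_p := ltn_ord q.
rewrite big_pred0 // (big_pred1 (ord_pred q)) => [|j]; last exact: ordS_eq.
rewrite !(Monoid.mul1m, Monoid.mulm1); congr (op _ _).
have spokeE (k : 'I_(4 * p).+1) : (vin (spoke k) == inr q :> chainV) =
    ((q == 0 :> nat) || (1 < q %% 6)%N) && (k == spoke_inv q :> nat).
  by rewrite -[LHS]/(inord _ == q) inord_eq ?spoke_lt // spoke_eq.
rewrite (eq_bigl _ _ spokeE).
have chordE (j : 'I_p) : (vin (6 * j + 6) == inr q :> chainV) = (6 * j + 6 == q)%N.
  by rewrite -[LHS]/(inord _ == q) inord_eq //; have := ltn_ord j; lia.
rewrite (eq_bigl _ _ chordE).
case: ifP => q6 /=.
  have inv_lt := spoke_inv_lt q_p q6.
  rewrite (big_pred1 (inord (spoke_inv q))) => [|k]; last by rewrite eq_sym -inord_eq // eq_sym.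
  by rewrite big_pred0 ?Monoid.mulm1 // => j; apply/eqP => q_j; move: q6; rewrite -q_j; lia.
rewrite big_pred0 // Monoid.mul1m; case: ifP => q61.
  by rewrite big_pred0 // => j; apply/eqP => q_j; move: q6 q61; rewrite -q_j; lia.
rewrite (big_pred1 (inord (q %/ 6).-1)) // => j.
rewrite /= [RHS]eq_sym inord_eq; move: q6 q61 q_p; rewrite /p;
  by move: (nat_of_ord q) (nat_of_ord j) => a b; lia.
Qed.

End Incidence.

Hypothesis t_gt0 : (0 < t)%N.

Lemma chain_regular : regular chain (2 * t + 1).
Proof.
move=> v; rewrite bundle_degree chain_out chain_in.
case: v => [k|q] /=; first lia.
by case: ifP => q1; case: ifP => q2; rewrite ?ifN; try lia.
Qed.

(** * Flow on the Petersen chain *)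

Section Flow.
Variable R : realType.

Let T : R := t%:R.
Let d : R := p%:R^-1.
Let lo : R := 2 * T - 1 - d.
Let hi : R := 2 * T + 1.
Let sg (k : nat) : R := if odd k then -1 else 1.
(** One slack [d = 1 / p] per block, on its third spoke: together they cancel the surplus 1 of the
    signs around the outer cycle of length [4 p + 1]. *)
Let z (k : nat) : R := if (k %% 4 == 3)%N then d else 0.

Let fout (k : nat) : R :=
  nth 0 [:: 2 * T - 1 + (k %/ 4)%:R * d; 2 * T + (k %/ 4)%:R * d;
            2 * T - 1 + (k %/ 4)%:R * d; 2 * T + ((k %/ 4)%:R + 1) * d] (k %% 4).

(** The slack accumulated before block [j] bypasses it through the chord bundle of net flow
    [2 - j d], so the values inside the block do not depend on [j]. *)
Let fin (q : nat) : R :=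
  nth 0 [:: 2 * T + 1 - (q %/ 6)%:R * d; 2 * T - 1; 2 * T; 2 * T + 1; 2 * T;
            2 * T - 1 - d] (q %% 6).

Definition chain_w (x : chainI) (l : nat) : R :=
  match x with
  | inl (inl k) => fout k
  | inl (inr q) => fin q
  | inr (inl k) => sg k * chord (2 * T - 1) (2 * T + 1) (z k) l
  | inr (inr j) => chord (2 * T - 1) (2 * T + 1) (1 - j%:R * d) l
  end.

Definition chain_net (x : chainI) : R :=
  match x with
  | inr (inl k) => sg k * (1 + z k)
  | inr (inr j) => 2 - j%:R * d
  | _ => chain_w x 0
  end.

Lemma chain_netE x : \sum_(l < chain_mu x) chain_w x l = chain_net x.
Proof.
have Tp : t.-1%:R = T - 1 by rewrite -subn1 natrB.
case: x => [[k|q]|[k|j]]; rewrite /chain_net /= ?big_ord1 //.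
  by rewrite -mulr_sumr sum_chord Tp; congr (_ * _); ring.
by rewrite sum_chord Tp; move: (T) (j%:R * d) => T' x; ring.
Qed.

Hypothesis t_gt1 : (1 < t)%N.

Let T2 : 2 <= T. Proof. by rewrite ler_nat. Qed.
Let d01 : 0 < d <= 1.
Proof. by rewrite /d invr_gt0 ltr0n invf_le1 ?ltr0n // ler1n. Qed.

Let jd_bounds j : (j <= p)%N -> 0 <= j%:R * d <= 1.
Proof.
move=> jp; rewrite mulr_ge0 //=; last by have := d01; lra.
by rewrite ler_pdivrMr ?ltr0n // mul1r ler_nat.
Qed.

Let pd : p%:R * d = 1. Proof. by rewrite divff // pnatr_eq0. Qed.

Lemma chain_w_bounds x l : lo <= `|chain_w x l| <= hi.
Proof.
have t2 := T2; have db := d01; case: x => [[k|q]|[k|j]] /=.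
- have := ltn_ord k; rewrite /fout /lo /hi; move: (nat_of_ord k) => {}k k_p.
  have rk : (k %% 4 < 4)%N by rewrite ltn_mod.
  have eq_k := divn_eq k 4; move: (k %/ 4)%N (k %% 4)%N rk eq_k => j r r4 eq_k.
  have B : 0 <= j%:R * d <= 1 by apply: jd_bounds; lia.
  move: r r4 eq_k => [|[|[|[|r]]]] // _ eq_k /=; rewrite ger0_norm; try lra.
    have := @jd_bounds j.+1 ltac:(lia); rewrite -natr1; lra.
- have := ltn_ord q; rewrite /fin /lo /hi; move: (nat_of_ord q) => {}q q_p.
  have rq : (q %% 6 < 6)%N by rewrite ltn_mod.
  have eq_q := divn_eq q 6; move: (q %/ 6)%N (q %% 6)%N rq eq_q => j r r6 eq_q.
  have B : 0 <= j%:R * d <= 1 by apply: jd_bounds; lia.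
  by move: r r6 eq_q => [|[|[|[|[|[|r]]]]]] // _ eq_q /=; rewrite ger0_norm; lra.
- have sgn (y : R) : `|sg k * y| = `|y|.
    by rewrite normrM /sg; case: ifP; rewrite ?normrN normr1 mul1r.
  by rewrite sgn; apply: chord_bounds; rewrite /lo /hi /z; try case: ifP; lra.
have B : 0 <= j%:R * d <= 1 by apply: jd_bounds; exact: ltnW.
by apply: chord_bounds; rewrite /lo /hi; lra.
Qed.

Let foutE j r : (r < 4)%N -> fout (j * 4 + r) =
  nth 0 [:: 2 * T - 1 + j%:R * d; 2 * T + j%:R * d;
            2 * T - 1 + j%:R * d; 2 * T + (j%:R + 1) * d] r.
Proof. by move=> r4; rewrite /fout divnMDl // modnMDl modn_small // divn_small // addn0. Qed.

Let finE j r : (r < 6)%N -> fin (j * 6 + r) =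
  nth 0 [:: 2 * T + 1 - j%:R * d; 2 * T - 1; 2 * T; 2 * T + 1; 2 * T; 2 * T - 1 - d] r.
Proof. by move=> r6; rewrite /fin divnMDl // modnMDl modn_small // divn_small // addn0. Qed.

Let sgE j r : sg (j * 4 + r) = sg r.
Proof. by rewrite /sg oddD oddM andbF. Qed.

Let zE j r : (r < 5)%N -> z (j * 4 + r) = if r == 3 then d else 0.
Proof. by rewrite /z modnMDl; move: r => [|[|[|[|[|r]]]]]. Qed.

Let fout_step k : fout k.+1 + sg k.+1 * (1 + z k.+1) = fout k.
Proof.
have rk : (k %% 4 < 4)%N by rewrite ltn_mod.
have := divn_eq k 4; move: (k %/ 4)%N (k %% 4)%N rk => j r r4 ->.
rewrite -addnS; move: r r4 => [|[|[|[|r]]]] // _.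
- by rewrite !foutE // sgE zE // /sg /=; move: (T) (j%:R * d) => T' x; ring.
- by rewrite !foutE // sgE zE // /sg /=; move: (T) (j%:R * d) => T' x; ring.
- by rewrite !foutE // sgE zE // /sg /=; move: (T) (j%:R) (d) => T' x d'; ring.
rewrite (_ : j * 4 + 4 = j.+1 * 4 + 0)%N; last by lia.
by rewrite !foutE // sgE zE // /sg /= -[j.+1%:R]natr1; move: (T) (j%:R) (d) => T' x d'; ring.
Qed.

Let fin_step q :
  fin q.+1 + (if (q.+1 %% 6 == 1)%N then 2 - (q.+1 %/ 6)%:R * d else 0) =
  fin q + (if (1 < q.+1 %% 6)%N then sg (spoke_inv q.+1) * (1 + z (spoke_inv q.+1))
           else if (q.+1 %% 6 == 1)%N then 0 else 2 - (q.+1 %/ 6).-1%:R * d).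
Proof.
have rq : (q %% 6 < 6)%N by rewrite ltn_mod.
have := divn_eq q 6; move: (q %/ 6)%N (q %% 6)%N rq => j r r6 ->.
rewrite -addnS; have [r5|r5] := ltnP r 5.
  rewrite /spoke_inv !finE // divnMDl // modnMDl modn_small // divn_small // addn0.
  rewrite mulnC sgE zE; last by move: r r5 {r6} => [|[|[|[|[|r]]]]].
  move: r r5 {r6} => [|[|[|[|[|r]]]]] // _; rewrite /sg /=;
    by move: (T) (d) => T' d'; ring.
have -> : r = 5 by lia.
rewrite (_ : j * 6 + 6 = j.+1 * 6 + 0)%N; last by lia.
rewrite !finE // modnMDl divnMDl //= addn0 /= -[j.+1%:R]natr1.
by move: (T) (d) => T' d'; ring.
Qed.

Let fout0 : fout 0 = 2 * T - 1.
Proof. by rewrite -[0%N]/(0 * 4 + 0)%N foutE //= mul0r addr0. Qed.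

Let fout_last : fout (4 * p) = 2 * T.
Proof. by rewrite -[(4 * p)%N]addn0 mulnC foutE //= pd addrNK. Qed.

Let fin0 : fin 0 = 2 * T + 1.
Proof. by rewrite -[0%N]/(0 * 6 + 0)%N finE //= mul0r subr0. Qed.

Let fin_last : fin (6 * p) = 2 * T.
Proof. by rewrite -[(6 * p)%N]addn0 mulnC finE //= pd addrK. Qed.

Lemma chain_flow : has_nowhere_zero_flow chain (1 + hi / lo).
Proof.
have t2 := T2; have db := d01.
apply: (@bundle_flow _ _ _ _ _ _ _ _ _ chain_w).
- by rewrite /lo; lra.
- by move=> x l _; exact: chain_w_bounds.
move=> v; under eq_bigr do rewrite chain_netE.
under [RHS]eq_bigr do rewrite chain_netE.
rewrite chain_out chain_in; case: v => [k|q].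
  rewrite /chain_net /= modn_pred_small //; case: k => -[|k] k_p /=; last exact: fout_step.
  (* Position 0 closes the outer cycle: [p * d = 1] makes its predecessor carry [2 T]. *)
  by rewrite fout0 fout_last /sg /z /=; ring.
have q_p := ltn_ord q; rewrite /chain_net /ispoke /ichord /= modn_pred_small //.
move: q_p; move: (nat_of_ord q) => {}q q_p.
have -> : (if (q %% 6 == 1)%N then 2 - (inord (q %/ 6) : 'I_p)%:R * d else 0) =
    if (q %% 6 == 1)%N then 2 - (q %/ 6)%:R * d else 0.
  by case: ifP => // q6; rewrite inordK //; move: q_p; rewrite /p; lia.
case: q q_p => [|q] q_p /=.
  rewrite fin0 fin_last (inordK (spoke_inv_lt q_p _)) //.
  by rewrite /spoke_inv /= /sg /z /=; ring.
rewrite fin_step; congr (_ + _); case: ifP => q6 /=.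
  by rewrite inordK // spoke_inv_lt.
by case: ifP => // q61; rewrite inordK //; move: q_p; rewrite /p; lia.
Qed.

End Flow.

(** * The chain is not colourable with its degree *)

Definition chain_star (v : chainV) : seq chainI :=
  match v with
  | inl k => [:: inl (inl k); inl (inl (ord_pred k)); inr (inl k)]
  | inr q => [:: inl (inr q); inl (inr (ord_pred q));
      if (q == 0 :> nat) || (1 < q %% 6)%N then ispoke (spoke_inv q)
      else if (q %% 6 == 1)%N then ichord (q %/ 6) else ichord (q %/ 6).-1]
  end.

Lemma spokeE j r : (r < 4)%N -> spoke (4 * j + r).+1 = (6 * j + nth 0 [:: 4; 2; 5; 3] r)%N.
Proof.
move=> r4; rewrite /spoke /= [(4 * j)%N]mulnC divnMDl // modnMDl.
by rewrite modn_small // divn_small // addn0.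
Qed.

Lemma spokeK k : (k < (4 * p).+1)%N ->
  ((spoke k == 0)%N || (1 < spoke k %% 6)%N) /\ spoke_inv (spoke k) = k.
Proof.
move=> k_p; have := spoke_eq k_p (spoke_lt k_p).
by rewrite eqxx => /esym/andP[-> /eqP].
Qed.

Lemma chain_starP x : (x \in chain_star (chain_src x)) && (x \in chain_star (chain_dst x)).
Proof.
case: x => [[k|q]|[k|j]]; rewrite /= !in_cons ?ordSK ?eqxx ?orbT //=.
  have [k0 kK] := spokeK (ltn_ord k).
  by rewrite inordK ?spoke_lt // k0 kK /ispoke inord_val eqxx.
have j_p := ltn_ord j; rewrite !inordK ?ltnS; try by move: j_p; rewrite /p; lia.
have -> : ((6 * j + 1) %/ 6 = j)%N by lia.
have -> : ((6 * j + 6) %/ 6 = j.+1)%N by lia.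
have -> : ((6 * j + 1) %% 6 = 1)%N by lia.
have -> : ((6 * j + 6) %% 6 = 0)%N by lia.
by rewrite addn1 addnS /= /ichord inord_val eqxx.
Qed.

Lemma ord_pred_inord n k : (k < n)%N -> ord_pred (inord k.+1 : 'I_n.+1) = inord k.
Proof.
move=> k_n; apply: val_inj; rewrite /= inordK // modn_pred_small // inordK //=.
exact: ltnW.
Qed.

Definition same_pair (C : Type) (a b c d : C) : Prop :=
  a <> b /\ (a = c /\ b = d \/ a = d /\ b = c).

(* [l0 .. l4] are the colours along the outer path of a block, [d1 .. d5] those along
   its inner path. A bundle of multiplicity [2 t - 1] leaves the same two colours to
   the single edges at both of its ends. *)
Lemma petersen_block (C : Type) (l0 l1 l2 l3 l4 d1 d2 d3 d4 d5 : C) :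
  same_pair l0 l1 d3 d4 -> same_pair l1 l2 d1 d2 -> same_pair l2 l3 d4 d5 ->
  same_pair l3 l4 d2 d3 -> l4 = l0.
Proof.
by move=> [n01 [[? ?]|[? ?]]] [n12 [[? ?]|[? ?]]] [n23 [[? ?]|[? ?]]] [n34 [[? ?]|[? ?]]];
  congruence.
Qed.

Lemma chain_not_colorable : ~~ edge_colorable chain (2 * t + 1).
Proof.
apply/negP => /edge_colorableP[c [ck c_inj]].
pose E x (k : 'I_(chain_mu x)) : edge chain := Tagged (fun x => 'I_(chain_mu x)) k.
pose col y := c (E (inl y) ord0).
pose inc v x := (v == chain_src x) || (v == chain_dst x).
have incE v x (l : 'I_(chain_mu x)) : inc v x -> v \in ends (E x l) by rewrite !inE.
have col_neq v y y' : inc v (inl y) -> inc v (inl y') -> y != y' -> col y <> col y'.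
  move=> vy vy' yy' cE.
  have /(congr1 tag) [yE] := c_inj _ _ v (incE v (inl y) ord0 vy) (incE v (inl y') ord0 vy') cE.
  by rewrite yE eqxx in yy'.
(* Every colour occurs at [w]. The colour of [y] cannot occur in the bundle [b], which also meets
   [y] at [u], so one of the two single edges at [w] has it. *)
have transfer u w y y1 y2 b : inc u (inl y) -> inc u (inr b) ->
    chain_star w = [:: inl y1; inl y2; inr b] -> col y = col y1 \/ col y = col y2.
  move=> uy ub wE.
  have [e we ce] := @regular_full_coloring chain _ c w _ chain_regular ck c_inj
    (ck (E (inl y) ord0)).
  have ew : tag e \in chain_star w.
    have /andP[] := chain_starP (tag e).
    by move: we; rewrite !inE => /orP[]/eqP->.
  case: e ew we ce => x l /=; rewrite wE !inE => /or3P[]/eqP xE; subst x.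
  - by move=> _ ce; left; rewrite /col -ce /E (ord1 l).
  - by move=> _ ce; right; rewrite /col -ce /E (ord1 l).
  by move=> _ /(c_inj _ _ u (incE u (inr b) l ub) (incE u (inl y) ord0 uy)) /(congr1 tag).
pose co k := col (inl (inord k)); pose ci q := col (inr (inord q)).
have star_out k : (k < 4 * p)%N -> chain_star (vout k.+1) =
    [:: inl (inl (inord k.+1)); inl (inl (inord k)); ispoke k.+1].
  by move=> k_p; rewrite /= ord_pred_inord.
have star_in k q : (k < 4 * p)%N -> spoke k.+1 = q.+1 -> chain_star (vin q.+1) =
    [:: inl (inr (inord q.+1)); inl (inr (inord q)); ispoke k.+1].
  move=> k_p kE; have k1 : (k.+1 < (4 * p).+1)%N by [].
  have q_p := spoke_lt k1; have [kq kK] := spokeK k1.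
  by rewrite /= ord_pred_inord -?kE // inordK // kq kK.
(* Both cycle colours at the outer end of a spoke bundle transfer to its inner end, and being
   distinct they exhaust the pair there. *)
have pairs k q : (k < 4 * p)%N -> spoke k.+1 = q.+1 ->
    same_pair (co k) (co k.+1) (ci q) (ci q.+1).
  move=> k_p kE; have si := star_in _ _ k_p kE.
  have io : inc (vout k.+1) (ispoke k.+1) by rewrite /inc /= eqxx.
  have o1 : inc (vout k.+1) (iout k.+1) by rewrite /inc /= eqxx.
  have o0 : inc (vout k.+1) (iout k).
    by rewrite /inc /= -(ord_pred_inord k_p) ord_predK eqxx ?orbT.
  have neq : co k <> co k.+1.
    apply: (col_neq _ _ _ o0 o1); apply/eqP => -[/(congr1 (@nat_of_ord _))].
    by rewrite !inordK //; lia.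
  have e0 : co k = ci q.+1 \/ co k = ci q := transfer _ _ _ _ _ _ o0 io si.
  have e1 : co k.+1 = ci q.+1 \/ co k.+1 = ci q := transfer _ _ _ _ _ _ o1 io si.
  by split=> //; case: e0 => e0; case: e1 => e1; [case: neq|right|left|case: neq]; rewrite ?e0 ?e1.
(* The four spokes of the block, at inner offsets 4, 2, 5, 3, supply the four hypotheses of
   [petersen_block] in this order. *)
have block j : (j < p)%N -> co (4 * j.+1)%N = co (4 * j)%N.
  move=> jp; rewrite mulnS addnC.
  apply: (@petersen_block _ _ (co (4 * j + 1)%N) (co (4 * j + 2)%N) (co (4 * j + 3)%N) _
    (ci (6 * j + 1)%N) (ci (6 * j + 2)%N) (ci (6 * j + 3)%N) (ci (6 * j + 4)%N)
    (ci (6 * j + 5)%N)).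
  - by have := pairs (4 * j + 0)%N (6 * j + 3)%N; rewrite spokeE //= -!addnS addn0; apply; lia.
  - by have := pairs (4 * j + 1)%N (6 * j + 1)%N; rewrite spokeE //= -!addnS; apply; lia.
  - by have := pairs (4 * j + 2)%N (6 * j + 4)%N; rewrite spokeE //= -!addnS; apply; lia.
  by have := pairs (4 * j + 3)%N (6 * j + 2)%N; rewrite spokeE //= -!addnS; apply; lia.
have co_const j : (j <= p)%N -> co (4 * j)%N = co 0%N.
  by elim: j => [|j IHj] jp; rewrite ?muln0 // block // IHj // ltnW.
(* The two outer edges at position 0 are adjacent, yet [co_const] gives them the same colour. *)
apply: (col_neq (vout 0) (inl (inord 0)) (inl (inord (4 * p)))); last by rewrite -!/(co _) co_const.
- by rewrite /inc /= eqxx.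
- rewrite /inc /=; apply/orP; right; apply/eqP; congr inl; apply: val_inj.
  by rewrite /= !inordK // modnn.
by apply/eqP => -[/(congr1 (@nat_of_ord _))]; rewrite !inordK //; lia.
Qed.

End PetersenChain.

(** * The infima *)

Section Infimum.
Variables (R : realType) (t : nat).
Hypothesis t_gt1 : (1 < t)%N.

Let bound : R := 2 + 2 / (2 * t%:R - 1).

Let t2 : 2 <= t%:R :> R. Proof. by rewrite ler_nat. Qed.

Lemma circular_flow_number_ge (G : mgraph) : regular G (2 * t + 1) -> ~ bipartite G ->
  (bound%:E <= circular_flow_number R G)%E.
Proof.
move=> regG nbip; apply: le_ereal_inf_tmp => _ [r [r2 [tl [hd [f flow]]]] <-].
rewrite lee_fin leNgt; apply/negP => r_lt; apply: nbip.
by apply: (flow_bipartite (ltnW t_gt1) regG r_lt flow).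
Qed.

Lemma circular_flow_number_le (G : mgraph) (r : R) : 2 <= r -> has_nowhere_zero_flow G r ->
  (circular_flow_number R G <= r%:E)%E.
Proof. by move=> r2 flow; apply: ereal_inf_lbound; exists r. Qed.

(** Write [L = 2 t - 1], [q = (2 t + 1) / L] and [d = 1 / k]. Then
    [(q + d)(L - d) = q L + d (L - d - q)], and the last bracket is nonnegative because [L >= 3],
    [d <= 1] and [q <= 2]. *)
Lemma flow_ratio_bounds (k : nat) : (0 < k)%N ->
  2 <= 1 + (2 * t%:R + 1) / (2 * t%:R - 1 - k%:R^-1 : R) <= bound + k%:R^-1.
Proof.
move=> k0; have := t2; rewrite /bound.
have k1 : 0 < (k%:R^-1 : R) <= 1.
  by rewrite invr_gt0 ltr0n k0 invf_le1 ?ltr0n // ler1n.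
move: (t%:R) (k%:R^-1) k1 => x d d01 x2.
have lo0 : 0 < 2 * x - 1 - d by lra.
apply/andP; split.
  by rewrite -lerBlDl ler_pdivlMr //; lra.
have -> : 2 + 2 / (2 * x - 1) + d = 1 + ((2 * x + 1) / (2 * x - 1) + d).
  by field; lra.
rewrite lerD2l ler_pdivrMr //.
have -> : ((2 * x + 1) / (2 * x - 1) + d) * (2 * x - 1 - d) =
    2 * x + 1 + d * (2 * x - 1 - d - (2 * x + 1) / (2 * x - 1)).
  by field; lra.
rewrite lerDl mulr_ge0 //; first by lra.
have : (2 * x + 1) / (2 * x - 1) <= 2 by rewrite ler_pdivrMr; lra.
lra.
Qed.

(** Serves both infima: non-bipartite members stay above the bound, and the flow ratios come within
    [1 / k] of it, with [k] taken above [1 / e]. *)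
Lemma circular_flow_inf_eq (P : mgraph -> Prop) :
  (forall G, P G -> regular G (2 * t + 1) /\ ~ bipartite G) ->
  (forall k, (0 < k)%N -> exists2 G, P G &
     has_nowhere_zero_flow G (1 + (2 * t%:R + 1) / (2 * t%:R - 1 - k%:R^-1) : R)) ->
  ereal_inf (fun x => exists2 G, P G & x = circular_flow_number R G) = bound%:E.
Proof.
move=> Pge Ple; apply/eqP; rewrite eq_le; apply/andP; split.
  apply/lee_addgt0Pr => e e0; have ei0 : 0 <= e^-1 by rewrite invr_ge0 ltW.
  have := archi_boundP ei0; set k := Num.Def.archi_bound _ => e_k.
  have k0 : (0 < k)%N by rewrite -(ltr0n R); apply: le_lt_trans e_k.
  have [G PG flow] := Ple k k0; apply: ge_ereal_inf.
  exists (circular_flow_number R G); first by exists G.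
  have /andP[r2 rb] := flow_ratio_bounds k0.
  apply: le_trans (circular_flow_number_le r2 flow) _.
  rewrite -EFinD lee_fin (le_trans rb) // lerD2l -[leRHS]invrK lef_pV2 ?ltW //.
    by rewrite posrE ltr0n.
  by rewrite posrE invr_gt0.
apply: le_ereal_inf_tmp => _ [G /Pge[regG nbip] ->].
exact: circular_flow_number_ge.
Qed.

End Infimum.

Theorem corollary2p9 (R : realType) (t : nat) (ht : (2 <= t)%N) :
  Phi1 R (2 * t + 1)%N = (2 + 2 / (2 * t%:R - 1))%:E /\
  Phi2 R (2 * t + 1)%N = (2 + 2 / (2 * t%:R - 1))%:E.
Proof.
have t_gt0 : (0 < t)%N by exact: ltnW.
split; apply: circular_flow_inf_eq => //.
- move=> G [regG _ noM]; split=> // /bipartite_regular_matching bipG.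
  by apply: noM; apply: bipG regG _; rewrite addn1.
- move=> k k0; exists (flower t k0); last exact: flower_flow.
  split; first exact: flower_regular.
    exact: regular_class1 (flower_regular ht) (flower_colorable _ ht).
  exact: flower_no_matching.
- by move=> G [regG cl2]; split=> // bipG; apply: cl2; exact: bipartite_regular_class1 regG.
(* [chain s t] has [s.+1] blocks, so its slack is [1 / s.+1]. *)
case=> // s _; exists (chain s t); last exact: chain_flow.
have regC := @chain_regular s t t_gt0; split=> // /class1_colorable.
rewrite (max_degree_regular (vout s 0 : vertex (chain s t)) regC); apply/negP.
exact: chain_not_colorable.
Qed.
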